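(* Let $\kappa_1,\kappa_2,g_1,g_2$ be positive integers. Suppose that there exists a cubic $\kappa_1$-connected graph $G_1$ with girth $g_1$ having a unique longest cycle, that there exists a cubic graph $G_2$ with girth $g_2$ having precisely three hamiltonian cycles, and that there is a vertex $u \in V(G_2)$ such that $G_2-u$ is $\kappa_2$-connected. Then there exists an infinite family of (pairwise non-isomorphic) cubic $\min\{\kappa_1,\kappa_2\}$-connected graphs, each with girth at least $\min\{2g_1,g_2\}$ and each having a unique longest cycle.
   Context: All graphs are finite and simple. A graph is cubic if every vertex has degree $3$. The girth of a graph is the length of a shortest cycle in it. A graph has a unique longest cycle if, among all cycles of the graph, exactly one cycle (as a subgraph) has maximum length. A hamiltonian cycle is a cycle passing through every vertex. *)

(* Defs.v *)
From mathcomp Require Import all_boot.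

Set Implicit Arguments.
Unset Strict Implicit.
Unset Printing Implicit Defensive.

Record sgraph := SGraph {
  vertex :> finType;
  adj : rel vertex;
  adj_sym : symmetric adj;
  adj_irrefl : irreflexive adj
}.

Definition sgraph_iso (G H : sgraph) : Prop :=
  exists2 f : G -> H, bijective f & forall x y, adj (f x) (f y) = adj x y.

Definition cubic (G : sgraph) : Prop :=
  forall x : G, #|[set y | adj x y]| = 3.

Section DeleteVertices.
Variables (G : sgraph) (S : {set G}).

Definition del_adj : rel {x : G | x \notin S} :=
  fun x y => adj (val x) (val y).

Lemma del_adj_sym : symmetric del_adj.
Proof. by move=> x y; apply: adj_sym. Qed.

Lemma del_adj_irrefl : irreflexive del_adj.
Proof. by move=> x; apply: adj_irrefl. Qed.

Definition del_vertices : sgraph := SGraph del_adj_sym del_adj_irrefl.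
End DeleteVertices.

Definition connected (G : sgraph) : Prop :=
  forall x y : G, connect (@adj G) x y.

Definition k_connected (k : nat) (G : sgraph) : Prop :=
  k < #|G| /\ forall S : {set G}, #|S| < k -> connected (del_vertices S).

(* A subgraph is given by its vertex set and its edge set, an edge being a
   two-element set of vertices.  Sequences that differ by a rotation or a
   reversal trace out the same subgraph. *)
Definition subgraph (G : sgraph) : Type := ({set G} * {set {set G}})%type.

Definition subgraph_of_seq (G : sgraph) (c : seq G) : subgraph G :=
  ([set x in c], [set [set x; next c x] | x in c]).

(* [ucycle] also accepts sequences of size at most 2, which are not cycles
   of a simple graph. *)
Definition is_cycle (G : sgraph) (C : subgraph G) : Prop :=
  exists c : seq G,
    [/\ 3 <= size c, ucycle (@adj G) c & C = subgraph_of_seq c].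

Definition cycle_length (G : sgraph) (C : subgraph G) : nat := #|C.2|.

Definition has_girth (G : sgraph) (g : nat) : Prop :=
  (exists2 C : subgraph G, is_cycle C & cycle_length C = g) /\
  (forall C : subgraph G, is_cycle C -> g <= cycle_length C).

Definition longest_cycle (G : sgraph) (C : subgraph G) : Prop :=
  is_cycle C /\
  forall D : subgraph G, is_cycle D -> cycle_length D <= cycle_length C.

Definition unique_longest_cycle (G : sgraph) : Prop :=
  exists! C : subgraph G, longest_cycle C.

Definition hamiltonian_cycle (G : sgraph) (C : subgraph G) : Prop :=
  is_cycle C /\ C.1 = [set: G].

Definition num_hamiltonian_cycles (G : sgraph) (n : nat) : Prop :=
  exists s : seq (subgraph G),
    [/\ uniq s, size s = n & forall C, C \in s <-> hamiltonian_cycle C].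

(* Main.v *)
Require Import Defs.
From mathcomp Require Import all_boot zify.

(** Replace every vertex of [G1] by a copy of [G2 - u], the three edges at the vertex being
    attached to the three neighbours of [u].  A cycle of the new graph that is not
    contained in a copy meets each copy at most once, so contracting the copies turns
    it into a cycle of [G1], and contracting everything outside a copy to [u] turns it
    into a cycle of [G2] through [u]; this yields the girth bound.  By Smith's theorem
    every edge of a cubic graph lies on an even number of hamiltonian cycles, hence the
    three hamiltonian cycles of [G2] miss one edge at [u] each, and [G2 - u] has exactly
    one hamiltonian path between any two neighbours of [u].  The longest cycles of the
    new graph thus arise from the longest cycle of [G1] by inserting these
    paths.  Since the new graph inherits the hypotheses on [G1], the construction
    can be iterated. *)

Set Implicit Arguments.
Unset Strict Implicit.
Unset Printing Implicit Defensive.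

(** * Neighbourhoods and supports of relations on a finite type, and a parity principle *)

Section Relations.
Variable T : finType.
Implicit Types (r : rel T) (K : {set T}).

Definition nbh r (x : T) : {set T} := [set y | r x y].

Definition supp r : {set T} := [set x | [exists y, r x y]].

Definition closed_set r K := forall x y, r x y -> x \in K -> y \in K.

Lemma suppP r x : reflect (exists y, r x y) (x \in supp r).
Proof. by rewrite inE; apply: existsP. Qed.

Lemma mem_supp r x y : r x y -> x \in supp r.
Proof. by move=> rxy; apply/suppP; exists y. Qed.

Lemma nbh_supp0 r x : x \notin supp r -> nbh r x = set0.
Proof.
move=> xr; apply/setP=> y; rewrite !inE; apply/negP=> rxy.
by case/negP: xr; apply: mem_supp rxy.
Qed.

Lemma supp_nbh r x : (x \in supp r) = (0 < #|nbh r x|).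
Proof. by rewrite card_gt0; apply/suppP/set0Pn=> -[y yx]; exists y; rewrite inE in yx *. Qed.

Lemma eq_supp r1 r2 : r1 =2 r2 -> supp r1 = supp r2.
Proof. by move=> e; apply/setP=> x; rewrite !inE; apply: eq_existsb => y. Qed.

(** Removing [x] and [f x] together takes two elements away and leaves a set on which [f] is again
    such an involution. *)
Lemma even_fpf_involution (A : {set T}) (f : T -> T) :
  {in A, forall x, [/\ f x \in A, f (f x) = x & f x != x]} -> ~~ odd #|A|.
Proof.
have [n] := ubnP #|A|; elim: n A => // n IH A ltAn fA.
have [->|[x xA]] := set_0Vmem A; first by rewrite cards0.
have [fxA ffx fx] := fA x xA.
have fxA' : f x \in A :\ x by rewrite !inE fx.
rewrite (cardsD1 x) xA (cardsD1 (f x)) fxA' !add1n /= negbK.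
apply: IH => [|y].
  by move: ltAn; rewrite (cardsD1 x) xA (cardsD1 (f x)) fxA'; lia.
rewrite !inE => /and3P[yfx yx yA]; have [fyA ffy fy] := fA y yA.
split=> //; rewrite fyA andbT; apply/andP; split.
  by apply: contraNneq yx => e; rewrite -ffy e ffx.
by apply: contraNneq yfx => e; rewrite -ffy e.
Qed.

End Relations.

(** Restates connectivity after deletion through sets of vertices of [G] itself, which keeps the
    subtype of surviving vertices out of later arguments. For the converse, [K] is the set of
    vertices reachable from [x]. *)
Lemma connected_offP (G : sgraph) (S : {set G}) :
  connected (del_vertices S) <->
  (forall K : {set G},
     (forall x y, x \notin S -> y \notin S -> adj x y -> x \in K -> y \in K) ->
     forall x y, x \notin S -> y \notin S -> x \in K -> y \in K).
Proof.
split=> [conn K clK x y xS yS xK|conn x y].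
  have /connectP[p] := conn (Sub x xS) (Sub y yS).
  have : val (Sub x xS : {x | x \notin S}) \in K by [].
  elim: p (Sub x xS : {x | x \notin S}) => [|b p IH] a aK /=.
    by move=> _ e; rewrite -[y]/(val (Sub y yS : {x | x \notin S})) e.
  case/andP=> ab pb; apply: IH pb.
  exact: (clK _ _ (valP a) (valP b) ab aK).
pose K := [set z : G | [exists b : {x | x \notin S},
   (val b == z) && connect (@adj (del_vertices S)) x b]].
have: val (y : {x | x \notin S}) \in K.
  apply: (conn K _ (val (x : {x | x \notin S}))); rewrite ?(valP x) ?(valP y) //.
    move=> a b aS bS ab; rewrite !inE => /existsP[a' /andP[/eqP a'a xa']].
    apply/existsP; exists (Sub b bS); rewrite SubK eqxx /=.
    apply: connect_trans xa' (connect1 _).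
    by rewrite /= /del_adj SubK a'a.
  by rewrite inE; apply/existsP; exists x; rewrite eqxx connect0.
by rewrite inE => /existsP[b /andP[/eqP/val_inj-> ]].
Qed.

(** * Cycles as two-regular connected relations *)

(** Closed sets replace paths because preimages and images of closed sets are easy to handle under
    contraction and expansion. Only the support counts: vertices off the cycle are ignored. *)
Definition connected_rel (T : finType) (r : rel T) :=
  forall K : {set T}, closed_set r K ->
  forall x y, x \in supp r -> y \in supp r -> x \in K -> y \in K.

(** A cycle without base point or direction, given by its edges alone; contracting or expanding it
    can then be described edge by edge. *)
Definition cyc_rel (G : sgraph) (r : rel G) :=
  [/\ symmetric r, subrel r (@adj G),
      {in supp r, forall x, #|nbh r x| = 2}, supp r != set0 &
      connected_rel r].

Definition rel_of (G : sgraph) (C : subgraph G) : rel G :=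
  fun x y => [set x; y] \in C.2.

Definition subgraph_of_rel (G : sgraph) (r : rel G) : subgraph G :=
  (supp r, [set [set p.1; p.2] | p in [set p : G * G | r p.1 p.2]]).

Lemma set2_eqP (T : finType) (x y a b : T) :
  [set x; y] = [set a; b] -> x = a /\ y = b \/ x = b /\ y = a.
Proof.
move=> e.
have: x \in [set a; b] by rewrite -e set21.
have: y \in [set a; b] by rewrite -e set22.
have: a \in [set x; y] by rewrite e set21.
have: b \in [set x; y] by rewrite e set22.
by rewrite !inE; do 4![case/orP=> /eqP ?]; subst; auto.
Qed.

Lemma rel_ofK (G : sgraph) (r : rel G) :
  symmetric r -> rel_of (subgraph_of_rel r) =2 r.
Proof.
move=> symr x y; apply/imsetP/idP=> [[[a b]]|rxy].
  by rewrite inE /= => rab /set2_eqP[] [-> ->] //; rewrite symr.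
by exists (x, y); rewrite ?inE.
Qed.

Lemma eq_subgraph_of_rel (G : sgraph) (r1 r2 : rel G) :
  r1 =2 r2 -> subgraph_of_rel r1 = subgraph_of_rel r2.
Proof.
move=> e; rewrite /subgraph_of_rel (eq_supp e).
suff -> : [set p : G * G | r1 p.1 p.2] = [set p | r2 p.1 p.2] by [].
by apply/setP=> p; rewrite !inE e.
Qed.

Lemma next_head (T : eqType) (x y : T) s : next [:: x, y & s] x = y.
Proof. by rewrite next_nth mem_head /= eqxx. Qed.

Lemma prev_head (T : eqType) (x : T) s : x \notin s -> prev (x :: s) x = last x s.
Proof. by move=> xs; rewrite prev_nth mem_head memNindex // nth_last. Qed.

(** * From vertex sequences to cycle relations *)

Section CycleSeq.
Variables (G : sgraph) (c : seq G).
Hypotheses (c_gt2 : 2 < size c) (cyc_c : ucycle (@adj G) c).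
Let uniq_c : uniq c. Proof. by case/andP: cyc_c. Qed.

(** With [x] rotated to the front, the successor is the second entry and the predecessor the last
    one; these differ once there are three entries. *)
Lemma next_neq_prev x : x \in c -> next c x != prev c x.
Proof.
move=> xc; have [i s e] := rot_to xc.
rewrite -(next_rot i) // -(prev_rot i) // e.
have us: uniq (x :: s) by rewrite -e rot_uniq.
have: 2 < size (x :: s) by rewrite -e size_rot.
case: s us {e} => [|y [|z s]] // us _.
rewrite next_head prev_head; last by case/andP: us.
apply: contraTneq us => /= ey.
have -> : y \in z :: s by rewrite ey mem_last.
by rewrite andbF.
Qed.

Let C := subgraph_of_seq c.

Lemma rel_of_seqE x y :
  rel_of C x y = (x \in c) && ((y == next c x) || (y == prev c x)).
Proof.
apply/imsetP/andP=> [[z zc /set2_eqP[] [-> ->]]|[xc /orP[]/eqP->]].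
- by rewrite zc eqxx.
- by rewrite mem_next zc prev_next // eqxx orbT.
- by exists x.
- by exists (prev c x); rewrite ?mem_prev ?next_prev // setUC.
Qed.

Lemma rel_of_seq_sym : symmetric (rel_of C).
Proof. by move=> x y; rewrite /rel_of setUC. Qed.

Lemma supp_rel_of_seq : supp (rel_of C) = C.1.
Proof.
apply/setP=> x; rewrite [RHS]inE; apply/suppP/idP=> [[y]|xc].
  by rewrite rel_of_seqE => /andP[].
by exists (next c x); rewrite rel_of_seqE xc eqxx.
Qed.

Lemma nbh_rel_of_seq x : x \in c -> nbh (rel_of C) x = [set next c x; prev c x].
Proof. by move=> xc; apply/setP=> y; rewrite !inE rel_of_seqE xc. Qed.

Lemma cycle_rel_of_seq : cycle (rel_of C) c.
Proof.
apply: (@sub_in_cycle _ (mem c) (frel (next c))).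
- by move=> x y xc yc /= /eqP e; rewrite rel_of_seqE e eqxx andbT; apply: xc.
- by apply/allP.
- exact: cycle_next.
Qed.

Lemma card_vertices_seq : #|C.1| = size c.
Proof. by rewrite cardsE; apply/card_uniqP. Qed.

Lemma cyc_rel_of_seq : cyc_rel (rel_of C).
Proof.
have /andP[adjc _] := cyc_c.
split; rewrite ?supp_rel_of_seq.
- exact: rel_of_seq_sym.
- move=> x y; rewrite rel_of_seqE => /andP[xc /orP[]/eqP->].
    exact: next_cycle.
  by rewrite adj_sym; apply: prev_cycle.
- move=> x; rewrite inE => xc.
  by rewrite nbh_rel_of_seq // cards2 next_neq_prev.
- by rewrite -card_gt0 card_vertices_seq (leq_trans _ c_gt2).
- move=> K clK x y; rewrite supp_rel_of_seq !inE => xc yc xK.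
  have [i s e] := rot_to xc.
  have: cycle (rel_of C) (x :: s) by rewrite -e rot_cycle cycle_rel_of_seq.
  have: y \in x :: s by rewrite -e mem_rot.
  rewrite /= rcons_path => ys /andP[+ _].
  elim: s {e xc} x xK ys => [|a s IH] x xK /=.
    by rewrite inE => /eqP->.
  rewrite inE => /orP[/eqP-> //|ys] /andP[/clK/(_ xK) aK].
  exact: IH.
Qed.

Lemma subgraph_of_rel_of_seq : subgraph_of_rel (rel_of C) = C.
Proof.
rewrite /subgraph_of_rel supp_rel_of_seq [RHS]surjective_pairing; congr (_, _).
apply/setP=> E; apply/imsetP/idP=> [[[x y]]|/imsetP[x xc ->]].
  by rewrite inE => + ->.
by exists (x, next c x); rewrite // inE /= rel_of_seqE xc eqxx.
Qed.

Lemma card_edges_seq : #|C.2| = size c.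
Proof.
rewrite card_in_imset; first exact/card_uniqP.
(* If [x] and [y] were distinct with the same edge, each would be the successor of the other, so
   that the successor and the predecessor of [x] would agree. *)
move=> x y xc yc /set2_eqP[[] //|[ex ey]].
have := next_neq_prev xc; rewrite {1}ey.
by rewrite {1}ex prev_next // eqxx.
Qed.

End CycleSeq.

(** * From cycle relations back to vertex sequences *)

Section CycleRel.
Variable G : sgraph.
Implicit Types (C : subgraph G) (r : rel G).

Lemma is_cycle_cyc_rel C : is_cycle C -> cyc_rel (rel_of C).
Proof. by case=> c [c2 cc ->]; apply: cyc_rel_of_seq. Qed.

Lemma is_cycleK C : is_cycle C -> subgraph_of_rel (rel_of C) = C.
Proof. by case=> c [c2 cc ->]; apply: subgraph_of_rel_of_seq. Qed.

Lemma is_cycle_supp C : is_cycle C -> supp (rel_of C) = C.1.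
Proof. by case=> c [c2 cc ->]; apply: supp_rel_of_seq. Qed.

Lemma cycle_lengthE C : is_cycle C -> cycle_length C = #|C.1|.
Proof.
by case=> c [c2 cc ->]; rewrite /cycle_length card_edges_seq ?card_vertices_seq.
Qed.

Lemma cycle_length_gt2 C : is_cycle C -> 2 < cycle_length C.
Proof. by case=> c [c2 cc ->]; rewrite /cycle_length card_edges_seq. Qed.

(** A path whose end has a neighbour off the path can be prolonged, and the number of vertices
    bounds how often; the induction is on the room that is left. *)
Lemma maximal_path r x : exists2 p, path r x p && uniq (x :: p) &
  forall y, r (last x p) y -> y \in x :: p.
Proof.
suff: forall n p, #|G| - size p < n -> path r x p && uniq (x :: p) ->
    exists2 p, path r x p && uniq (x :: p) &
      forall y, r (last x p) y -> y \in x :: p.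
  by move/(_ _ [::] (ltnSn _)); apply.
elim=> // n IH p ltp pp.
have [/existsP[y /andP[ry yp]]|/existsPn max_p] :=
    boolP [exists y, r (last x p) y && (y \notin x :: p)]; last first.
  exists p => // y ry; apply: contraT => yp.
  by have := max_p y; rewrite ry yp.
apply: (IH (rcons p y)); last first.
  by rewrite rcons_path ry -rcons_cons rcons_uniq yp andbT.
have /andP[_ /card_uniqP /= sz] := pp.
have := max_card (mem (x :: p)); rewrite sz size_rcons => lt_p.
by rewrite subnS prednK // subn_gt0.
Qed.

(* The end of a maximal path has a second neighbour on the path, which can only
   be its origin since inner vertices already have their two neighbours. *)
Lemma cyc_rel_is_cycle r : cyc_rel r -> is_cycle (subgraph_of_rel r).
Proof.
case=> symr radj deg2 /set0Pn[x xr] conn.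
have rirr a b : r a b -> a != b.
  by move/radj; apply: contraTneq => ->; rewrite adj_irrefl.
have [p /andP[pp up] maxp] := maximal_path r x.
case/lastP: p => [|p z] in pp up maxp *.
  have /suppP[y rxy] := xr; have := maxp y rxy.
  by rewrite inE eq_sym (negPf (rirr _ _ rxy)).
rewrite last_rcons in maxp; move: pp; rewrite rcons_path => /andP[pp raz].
set a := last x p in raz.
have [b rzb nba] : exists2 b, r z b & b != a.
  have zr : z \in supp r by apply: (@mem_supp _ _ _ a); rewrite symr.
  have := deg2 z zr; rewrite (cardsD1 a) inE symr raz add1n => -[] /eqP/cards1P[b].
  by move/setP/(_ b); rewrite !inE eqxx => /andP[]; exists b.
have ucp : uniq (x :: p) && (z \notin x :: p).
  by move: up; rewrite -rcons_cons rcons_uniq andbC.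
have{ucp} /andP[uxp zxp] := ucp.
have bxp : b \in x :: p.
  have := maxp b rzb; rewrite -rcons_cons mem_rcons inE eq_sym.
  by rewrite (negPf (rirr _ _ rzb)).
have bx : b = x.
  move: bxp; rewrite inE => /orP[/eqP//|bp].
  case/splitPr: bp => p1 p2 in pp a raz nba uxp zxp {maxp up} *.
  case: p2 => [|d p2] in pp a raz nba uxp zxp *.
    by rewrite /a last_cat /= eqxx in nba.
  move: pp; rewrite cat_path /= => /and4P[_ rlb rbd _].
  have lp1 : last x p1 \in x :: p1 by rewrite mem_last.
  have : #|[set last x p1; d; z]| <= #|nbh r b|.
    apply/subset_leq_card/subsetP=> w; rewrite !inE => /orP[/orP[]|] /eqP->.
    - by rewrite symr.
    - by [].
    - by rewrite symr.
  move: uxp zxp; rewrite -cat_cons cat_uniq mem_cat negb_or.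
  case/and3P=> _ /hasPn dis u2 /andP[z1 z2].
  rewrite deg2 ?(mem_supp rbd) // setUC cardsU1 !inE cards2 negb_or !(eq_sym z).
  have -> : last x p1 != d.
    apply: contraTneq lp1 => ->; apply: (dis d).
    by rewrite !inE eqxx orbT.
  have -> : last x p1 != z by apply: contraNneq z1 => <-.
  have -> : d != z by apply: contraNneq z2 => <-; rewrite !inE eqxx orbT.
  by [].
pose c := x :: rcons p z.
have c2 : 2 < size c.
  have : p != [::] by apply: contraNneq nba => p0; rewrite /a p0 bx.
  by rewrite /c /= size_rcons; case: (p).
have rc : cycle r c.
  by rewrite /c /= !rcons_path pp raz last_rcons -bx.
have ac : ucycle (@adj G) c.
  by rewrite /ucycle up andbT; apply: sub_cycle rc.
pose C := subgraph_of_seq c.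
have [symC adjC degC _ _] := cyc_rel_of_seq c2 ac.
have suppC := supp_rel_of_seq ac.
have Cr : subrel (rel_of C) r.
  move=> v w; rewrite rel_of_seqE // => /andP[vc /orP[]/eqP->].
    exact: next_cycle.
  by rewrite symr; apply: prev_cycle.
(* Both neighbourhoods have two elements, so inclusion gives equality. Hence the vertices of [c] are
   closed under [r], and by connectedness [r] has no edge elsewhere. *)
have nbhC v : v \in c -> nbh (rel_of C) v = nbh r v.
  move=> vc; apply/eqP; rewrite eqEcard.
  have vC : v \in supp (rel_of C) by rewrite suppC inE.
  have vr : v \in supp r by case/suppP: vC => w /Cr; apply: mem_supp.
  rewrite degC // deg2 // leqnn andbT.
  by apply/subsetP=> w; rewrite !inE => /Cr.
have rC : rel_of C =2 r.
  move=> v w; have [vc|vc] := boolP (v \in c).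
    by have /setP/(_ w) := nbhC v vc; rewrite !inE.
  rewrite rel_of_seqE // (negPf vc); apply/esym/negP=> rvw.
  case/negP: vc; have: v \in [set w in c]; last by rewrite inE.
  apply: (conn _ _ x); rewrite ?(mem_supp rvw) ?xr // ?in_set ?mem_head //.
  move=> s t rst; rewrite !in_set => sc.
  have /setP/(_ t) := nbhC s sc; rewrite !in_set rst rel_of_seqE // sc andTb.
  by case/orP=> /eqP->; rewrite ?mem_next ?mem_prev.
exists c; split=> //.
by rewrite -(eq_subgraph_of_rel rC) subgraph_of_rel_of_seq.
Qed.

Lemma cycle_length_rel r :
  cyc_rel r -> cycle_length (subgraph_of_rel r) = #|supp r|.
Proof. by move/cyc_rel_is_cycle/cycle_lengthE. Qed.

Lemma cyc_rel_gt2 r : cyc_rel r -> 2 < #|supp r|.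
Proof.
by move=> cr; rewrite -cycle_length_rel // cycle_length_gt2 //; apply: cyc_rel_is_cycle.
Qed.

End CycleRel.

(** A cycle without one of its vertices is a path, hence still connected. This will be applied to
    the hamiltonian cycles of [G2] with [u] removed. *)
Lemma cyc_rel_minus_vertex (G : sgraph) (r : rel G) (u : G) (K : {set G}) :
  cyc_rel r -> u \in supp r ->
  (forall x y, r x y -> x != u -> y != u -> x \in K -> y \in K) ->
  forall x y, x \in supp r -> y \in supp r -> x != u -> y != u ->
  x \in K -> y \in K.
Proof.
move=> cr ur clK x y xr yr xu yu; have [symr _ _ _ _] := cr.
have [c [c2 cc Cc]] := cyc_rel_is_cycle cr.
have /andP[_ uc] := cc.
have memc z : (z \in supp r) = (z \in c).
  by have := supp_rel_of_seq cc; rewrite -Cc (eq_supp (rel_ofK symr)) Cc => ->; rewrite inE.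
have rc : cycle r c.
  have := cycle_rel_of_seq cc; rewrite -Cc.
  by rewrite (eq_cycle (rel_ofK symr)).
have [i s e] := rot_to (etrans (esym (memc u)) ur).
have mems z : z \in supp r -> z != u -> z \in s.
  by rewrite memc -(mem_rot i) e inE => /orP[->|].
have us : u \notin s by have := rot_uniq i c; rewrite e uc => /andP[].
have ps : path r u s by have := rot_cycle i r c; rewrite e rc /= rcons_path => /andP[].
case: s us ps {e} mems => [|a s] us ps mems; first by have := mems x xr xu.
(* The path [a :: s] starts right after [u] and avoids [u], so membership in [K] propagates along it
   in both directions. *)
suff aK z : z \in a :: s -> (z \in K) = (a \in K).
  by rewrite !aK ?mems.
move: ps us => /= /andP[_].
elim: s a {mems} => [|b s IH] a; first by move=> _ _; rewrite inE => /eqP->.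
rewrite /= inE negb_or => /andP[rab ps] /andP[ua us].
have ub : u != b by move: us; rewrite inE negb_or => /andP[].
rewrite inE => /orP[/eqP-> //|/(IH b ps us)->].
by apply/idP/idP; apply: clK; rewrite // ?[b == u]eq_sym ?[a == u]eq_sym // symr.
Qed.

(** * Traversing a cycle from a prescribed directed edge *)

Lemma subgraph_of_seq_rot (G : sgraph) i (c : seq G) :
  uniq c -> subgraph_of_seq (rot i c) = subgraph_of_seq c.
Proof.
move=> uc; congr (_, _); first by apply/setP=> x; rewrite !inE mem_rot.
apply/setP=> E; apply/imsetP/imsetP=> -[x]; rewrite ?mem_rot => xc ->.
  by exists x; rewrite ?next_rot.
by exists x; rewrite ?mem_rot ?next_rot.
Qed.

Lemma subgraph_of_seq_rev (G : sgraph) (c : seq G) :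
  uniq c -> subgraph_of_seq (rev c) = subgraph_of_seq c.
Proof.
move=> uc; congr (_, _); first by apply/setP=> x; rewrite !inE mem_rev.
apply/setP=> E; apply/imsetP/imsetP=> -[x]; rewrite ?mem_rev => xc ->.
  by exists (prev c x); rewrite ?mem_prev // next_rev // next_prev // setUC.
by exists (next c x); rewrite ?mem_rev ?mem_next // next_rev // prev_next // setUC.
Qed.

(** Rotating brings [x] to the front; if [y] is then the predecessor rather than the successor, the
    sequence is reversed first. *)
Lemma is_cycle_from (G : sgraph) (C : subgraph G) x y :
  is_cycle C -> rel_of C x y ->
  exists q, [/\ 2 < size [:: x, y & q], ucycle (@adj G) [:: x, y & q] &
                C = subgraph_of_seq [:: x, y & q]].
Proof.
have from_next c : 2 < size c -> ucycle (@adj G) c -> x \in c -> y = next c x ->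
    exists q, [/\ 2 < size [:: x, y & q], ucycle (@adj G) [:: x, y & q] &
                  subgraph_of_seq c = subgraph_of_seq [:: x, y & q]].
  move=> c2 cc xc yx; have /andP[ac uc] := cc.
  have [i s e] := rot_to xc.
  have: 2 < size (x :: s) by rewrite -e size_rot.
  case: s e => [|z s] // e c2'.
  have zy : z = y by rewrite yx -(next_rot i) // e next_head.
  exists s; rewrite -zy -e subgraph_of_seq_rot ?size_rot //; split=> //.
  by rewrite /ucycle rot_cycle rot_uniq ac.
case=> c [c2 cc ->]; rewrite rel_of_seqE // => /andP[xc].
have /andP[ac uc] := cc.
case/orP=> /eqP yx; first exact: from_next.
rewrite -subgraph_of_seq_rev //; apply: from_next; rewrite ?size_rev ?mem_rev //.
  rewrite /ucycle rev_uniq uc andbT rev_cycle.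
  by rewrite (eq_cycle (e' := @adj G)) // => a b; rewrite adj_sym.
by rewrite next_rev.
Qed.

Lemma next_nth_uniq (T : eqType) (x0 : T) (c : seq T) k :
  uniq c -> k.+1 < size c -> next c (nth x0 c k) = nth x0 c k.+1.
Proof.
move=> uc kc; rewrite next_nth mem_nth ?(ltnW kc) // index_uniq ?(ltnW kc) //.
by case: c uc kc => //= a s _ ks; apply: set_nth_default.
Qed.

(** The first two vertices fix the base point and the direction; every further vertex is the cycle
    neighbour of the current one that differs from the one before. The induction therefore carries
    two consecutive entries. *)
Lemma subgraph_of_seq_inj (G : sgraph) (x y : G) q q' :
  let c := [:: x, y & q] in let c' := [:: x, y & q'] in
  2 < size c -> ucycle (@adj G) c -> ucycle (@adj G) c' ->
  subgraph_of_seq c = subgraph_of_seq c' -> c = c'.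
Proof.
move=> c c' c2 cc cc' e.
have /andP[_ uc] := cc; have /andP[_ uc'] := cc'.
have sz : size c = size c'.
  by rewrite -(card_vertices_seq cc) -(card_vertices_seq cc') e.
suff eq_nth k : k.+1 < size c ->
    nth x c k = nth x c' k /\ nth x c k.+1 = nth x c' k.+1.
  apply: (@eq_from_nth _ x) => // -[|k] kc //.
  by have [] := eq_nth k kc.
elim: k => [|k IH] kc //; have [ek ek1] := IH (ltnW kc); split=> //.
have : rel_of (subgraph_of_seq c) (nth x c k.+1) (nth x c k.+2).
  by rewrite rel_of_seqE // mem_nth ?(ltnW kc) // next_nth_uniq // eqxx.
rewrite e ek1 rel_of_seqE // => /andP[_ /orP[]/eqP e2].
  by rewrite e2 next_nth_uniq // -sz.
have : nth x c k.+2 = nth x c k.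
  rewrite e2 -(next_nth_uniq x uc') -?sz ?(ltnW kc) // prev_next //.
by move/eqP; rewrite nth_uniq ?(ltnW (ltnW kc)) //; lia.
Qed.

(** * Smith's theorem *)

(* Thomason's lollipop argument: hamiltonian paths starting with the edge [x y]
   are paired by closing up the last vertex onto an inner vertex and reopening
   the path just after it. *)
Section Smith.
Variables (G : sgraph) (m : nat) (x y : G).
Hypotheses (cubG : cubic G) (cardG : #|G| = m.+3).

(** The lollipop move: the last vertex is joined to the entry at index [i.-1], and the edge from
    there to the entry at index [i] is dropped. *)
Definition flip i (p : seq G) := take i p ++ rev (drop i p).

Lemma perm_flip i p : perm_eq (flip i p) p.
Proof.
by rewrite -[X in perm_eq _ X](cat_take_drop i) perm_cat2l perm_rev.
Qed.

Lemma size_flip i p : size (flip i p) = size p.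
Proof. exact/perm_size/perm_flip. Qed.

Lemma nth_flip i p j : i <= size p -> j < size p ->
  nth x (flip i p) j = nth x p (if j < i then j else size p - j.+1 + i).
Proof.
move=> ip jp; rewrite nth_cat size_takel //; case: ltnP => [ji|ij].
  by rewrite nth_take.
rewrite nth_rev ?size_drop; last by rewrite ltn_sub2r // (leq_ltn_trans ij).
by rewrite nth_drop; congr nth; lia.
Qed.

Lemma flipK i p : flip i (flip i p) = p.
Proof.
have [ip|pi] := leqP i (size p); last first.
  by rewrite /flip !(take_oversize, drop_oversize, cats0) // ltnW.
rewrite /flip take_size_cat ?size_takel // drop_size_cat ?size_takel //.
by rewrite revK cat_take_drop.
Qed.

Lemma flip_tupleP i (p : m.+3.-tuple G) : size (flip i p) == m.+3.
Proof. by rewrite size_flip size_tuple. Qed.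

Definition flip_tuple i (p : m.+3.-tuple G) := Tuple (flip_tupleP i p).

(** It will be used on tuples of length [#|G|], where being duplicate-free already means visiting
    every vertex. *)
Definition ham_path (p : seq G) :=
  [&& uniq p, sorted (@adj G) p, nth x p 0 == x & nth x p 1 == y].

(** The only new adjacency is the one between positions [i.-1] and [i], which is the assumed chord;
    [1 < i] keeps [x] and [y] in place. *)
Lemma ham_path_flip i (p : m.+3.-tuple G) : 1 < i -> i < m.+2 ->
  adj (nth x p i.-1) (nth x p m.+2) -> ham_path p -> ham_path (flip i p).
Proof.
move=> i1 im ai /and4P[up sp p0 p1]; have sz := size_tuple p.
have szi : i <= m.+3 by lia.
apply/and4P; split; rewrite ?nth_flip ?sz ?i1 ?(ltnW i1) //.
  by rewrite (perm_uniq (perm_flip i p)).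
have /(sortedP x) adjp := sp.
apply/(sortedP x) => j; rewrite size_flip sz => jm.
rewrite !nth_flip ?sz ?(ltnW jm) //.
have [ji|ij] := ltnP j.+1 i; first by rewrite (ltnW ji) adjp ?sz.
have [ji|ij'] := ltnP j i.
  have -> : j = i.-1 by lia.
  by rewrite (_ : _ - _ + _ = m.+2) //; lia.
rewrite adj_sym (_ : m.+3 - j.+1 + i = (m.+3 - j.+2 + i).+1); last by lia.
by apply: adjp; rewrite sz; lia.
Qed.

(** Flipping at [i] is an involution on these paths: the dropped path edge becomes the chord of the
    new path. It has no fixed point because the old entry at index [i] becomes the last vertex. *)
Lemma even_lollipops i : 1 < i -> i < m.+2 ->
  ~~ odd #|[set p : m.+3.-tuple G |
            ham_path p && adj (nth x p i.-1) (nth x p m.+2)]|.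
Proof.
move=> i1 im; apply: (@even_fpf_involution _ _ (flip_tuple i)) => p.
rewrite !inE => /andP[hp ai]; have sz := size_tuple p.
have szi : i <= m.+3 by lia.
have /and4P[up /(sortedP x) adjp _ _] := hp.
have n1 : nth x (flip i p) i.-1 = nth x p i.-1.
  by rewrite nth_flip ?sz ?ifT //; lia.
have n2 : nth x (flip i p) m.+2 = nth x p i.
  by rewrite nth_flip ?sz ?ifF //; [congr nth; lia|lia].
split.
- rewrite ham_path_flip //= n1 n2 -{2}(prednK (ltnW i1)).
  by apply: adjp; rewrite sz; lia.
- by apply/val_inj; rewrite /= flipK.
- apply/eqP=> /(congr1 (fun q : m.+3.-tuple G => nth x q m.+2)) /=.
  by rewrite n2 => /eqP; rewrite nth_uniq ?sz //; lia.
Qed.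

(** Of the three neighbours of the last vertex, one is its predecessor, at index [m.+1]; the sum
    stops just before it. *)
Lemma ham_path_degree (p : m.+3.-tuple G) : ham_path p ->
  \sum_(0 <= j < m.+1) adj (nth x p j) (nth x p m.+2) = 2.
Proof.
case/and4P=> up /(sortedP x) adjp _ _; have sz := size_tuple p.
set z := nth x p m.+2.
have pT w : w \in p.
  have /subset_cardP: #|p| = #|G| by rewrite (card_uniqP up) sz.
  by move/(_ (subset_predT _)) => ->.
have : \sum_(0 <= j < m.+3) adj (nth x p j) z = 3.
  rewrite -(cubG z) -sum1dep_card [RHS]big_mkcond /=.
  have <- : \sum_(w <- p) adj w z = \sum_(0 <= j < m.+3) adj (nth x p j) z.
    by rewrite (big_nth x) sz.
  rewrite big_uniq //=; apply: eq_big => w; first by rewrite pT.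
  by move=> _; rewrite adj_sym; case: ifP.
by rewrite (big_nat_recr m.+2) // (big_nat_recr m.+1) // adj_irrefl adjp ?sz // /= addn0 addn1 => -[].
Qed.

(** Double counting of the pairs of a path and a chord at its last vertex. Each path has two chords,
    so the total is even; the chords ending at index at least 1 contribute evenly by
    [even_lollipops], hence so do those ending at index 0. *)
Lemma even_closed_ham_paths :
  ~~ odd #|[set p : m.+3.-tuple G | ham_path p && adj (nth x p 0) (nth x p m.+2)]|.
Proof.
pose A j := [set p : m.+3.-tuple G | ham_path p && adj (nth x p j) (nth x p m.+2)].
have: \sum_(0 <= j < m.+1) #|A j| = 2 * #|[set p : m.+3.-tuple G | ham_path p]|.
  under eq_bigr do rewrite -sum1dep_card big_mkcondr.
  rewrite exchange_big /= -sum1dep_card big_distrr /=.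
  apply: eq_bigr => p hp; rewrite muln1 -(ham_path_degree hp).
  by apply: eq_bigr => j _; case: ifP.
rewrite big_nat_recl // -/(A 0).
suff : ~~ odd (\sum_(0 <= i < m) #|A i.+1|).
  by move=> /negPf even_sum /(congr1 odd); rewrite oddD even_sum addbF oddM => ->.
rewrite big_nat; apply: (big_ind (fun k => ~~ odd k)) => // [a b|i /andP[_ im]].
  by rewrite oddD => /negPf-> /negPf->.
(* A chord ending at index [i.+1] belongs to the flip at [i.+2]. *)
by apply: (@even_lollipops i.+2).
Qed.

Lemma closed_ham_path_cycle (p : m.+3.-tuple G) :
  ham_path p -> adj (nth x p 0) (nth x p m.+2) ->
  exists2 q, val p = [:: x, y & q] & ucycle (@adj G) p.
Proof.
case: p => -[|a [|b q]] // sz /and4P[up sp /= /eqP ax /eqP bY]; subst a b.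
have lastE : nth x [:: x, y & q] m.+2 = last x (y :: q).
  by rewrite -[m.+2]/(m.+3.-1) -(eqP sz) nth_last.
move=> ac; have {}ac : adj x (nth x [:: x, y & q] m.+2) by [].
rewrite lastE in ac.
exists q; rewrite // /ucycle [X in _ && X]up andbT.
rewrite -[cycle _ _]/(path _ x (rcons (y :: q) x)) rcons_path adj_sym.
by apply/andP.
Qed.

(** Each hamiltonian cycle through the edge arises from exactly one closed hamiltonian path
    beginning with [x] and [y], so the parity of the closed paths carries over. *)
Lemma smith (s : seq (subgraph G)) :
  uniq s -> (forall C, C \in s <-> hamiltonian_cycle C) ->
  ~~ odd (count (fun C => rel_of C x y) s).
Proof.
move=> us memE.
pose P := [set p : m.+3.-tuple G | ham_path p && adj (nth x p 0) (nth x p m.+2)].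
have Pcyc p : p \in P -> exists2 q, val p = [:: x, y & q] & ucycle (@adj G) p.
  by rewrite inE => /andP[]; apply: closed_ham_path_cycle.
have Psize (p : m.+3.-tuple G) : 2 < size p by rewrite size_tuple.
rewrite -size_filter -(card_uniqP (filter_uniq _ us)).
rewrite (_ : #|_| = #|[set subgraph_of_seq (val p) | p in P]|); last first.
  apply: eq_card => C; rewrite mem_filter; apply/andP/imsetP.
    case=> rC /memE[cycC C1].
    have [q [q2 cq eC]] := is_cycle_from cycC rC.
    have sz : size [:: x, y & q] == m.+3.
      by rewrite -(card_vertices_seq cq) -eC C1 cardsT cardG.
    exists (Tuple sz) => //; have /andP[aq uq] := cq.
    move: aq; rewrite /cycle rcons_path => /andP[aq ac].
    rewrite inE; apply/andP; split; first by apply/and4P; split.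
    have : adj (nth x [:: x, y & q] m.+2) x; last by rewrite adj_sym.
    by rewrite -[m.+2]/(m.+3.-1) -(eqP sz) nth_last.
  case=> p pP ->; have [q ep cp] := Pcyc p pP; split.
    by rewrite rel_of_seqE // ep mem_head next_head eqxx.
  apply/memE; split; first by exists (val p); split=> //; apply: Psize.
  by apply/eqP; rewrite eqEcard subsetT cardsT cardG card_vertices_seq ?size_tuple ?leqnn.
rewrite card_in_imset; first exact: even_closed_ham_paths.
move=> p p' /Pcyc[q ep cp] /Pcyc[q' ep' cp'] e; apply/val_inj.
rewrite /= -!/(val _) ep ep' in cp cp' e *.
by apply: subgraph_of_seq_inj => //; have := Psize p; rewrite ep.
Qed.

End Smith.

Lemma count1_inj (T : eqType) (P : pred T) (s : seq T) a b :
  count P s = 1 -> a \in s -> b \in s -> P a -> P b -> a = b.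
Proof.
rewrite -size_filter => s1 sa sb Pa Pb.
have: a \in filter P s by rewrite mem_filter Pa.
have: b \in filter P s by rewrite mem_filter Pb.
by case: (filter P s) s1 => [|c [|]] // _; rewrite !inE => /eqP-> /eqP->.
Qed.

(* By Smith's theorem the numbers of hamiltonian cycles missing each of the three
   edges at [u] are odd, and they add up to three. *)
Lemma three_hamiltonian_cycles (G : sgraph) (u : G) :
  cubic G -> num_hamiltonian_cycles G 3 ->
  exists ham : {set G} -> subgraph G,
    forall A : {set G}, A \subset nbh (@adj G) u -> #|A| = 2 ->
    [/\ hamiltonian_cycle (ham A), nbh (rel_of (ham A)) u = A &
        forall C, hamiltonian_cycle C -> nbh (rel_of C) u = A -> C = ham A].
Proof.
move=> cubG [s [us s3 memE]].
have [m cardG] : exists m, #|G| = m.+3.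
  exists (#|G| - 3); have := max_card (mem (nbh (@adj G) u)).
  by rewrite [#|_|]cubG => /subnK <-; rewrite addnK addn3.
pose C0 := head (set0, set0) s.
pose P A (C : subgraph G) := nbh (rel_of C) u == A.
(* The first listed cycle with neighbourhood [A] at [u]; for the sets [A] in question the search
   succeeds, so the default [C0] is not returned. *)
exists (fun A => nth C0 s (find (P A) s)) => A sA A2.
suff cnt : count (P A) s = 1.
  have hasA : has (P A) s by rewrite has_count cnt.
  have memA : nth C0 s (find (P A) s) \in s by rewrite mem_nth // -has_find.
  have PA := nth_find C0 hasA.
  split; [exact/memE | exact/eqP | move=> C /memE Cs /eqP PC].
  exact: count1_inj cnt _ _ PC PA.
have hamN C : C \in s -> #|nbh (rel_of C) u| = 2 /\
    nbh (rel_of C) u \subset nbh (@adj G) u.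
  move=> /memE[cycC C1]; have [_ sub deg _ _] := is_cycle_cyc_rel cycC.
  split; first by apply: deg; rewrite is_cycle_supp // C1 inE.
  by apply/subsetP=> w; rewrite !inE => /sub.
have [d dA eA] : exists2 d, adj u d & A = nbh (@adj G) u :\ d.
  have /cards1P[d ed] : #|nbh (@adj G) u :\: A| == 1.
    by rewrite cardsD (setIidPr sA) [#|nbh _ _|]cubG A2.
  have := set11 d; rewrite -ed !inE => /andP[dA ud]; exists d => //.
  by rewrite -ed setDDr setDv set0U (setIidPr sA).
(* A hamiltonian cycle uses two of the three edges at [u], so using the two edges towards [A]
   amounts to missing the one to [d]. *)
have missE C : C \in s -> P A C = ~~ rel_of C u d.
  move=> /hamN[C2 Csub]; rewrite /P eqEcard C2 A2 leqnn andbT eA.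
  apply/subsetP/idP => [sub|nd w wC].
    by apply/negP=> rd; have := sub d; rewrite !inE rd eqxx => /(_ isT).
  rewrite !inE; have := subsetP Csub w wC; rewrite inE => ->; rewrite andbT.
  by apply: contraNneq nd => <-; rewrite inE in wC.
have [b [c [bc bd cd uE]]] : exists b c, [/\ b != c, b != d, c != d &
    nbh (@adj G) u = [set d; b; c]].
  move: A2 => /eqP/cards2P[b [c [bc eA2]]]; exists b, c.
  move: eA2; rewrite eA => eA2.
  have := set21 b c; have := set22 b c; rewrite -eA2 !inE.
  move=> /andP[cd _] /andP[bd _]; split=> //.
  by rewrite -setUA -eA2 setD1K // inE.
have row C : C \in s -> rel_of C u d + rel_of C u b + rel_of C u c = 2.
  case/hamN=> C2 Csub; rewrite -C2 -sum1dep_card big_mkcond /=.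
  rewrite (bigD1 d) // (bigD1 b) // (bigD1 c) /=; last by rewrite cd eq_sym.
  rewrite big1 ?addn0 => [|w /andP[/andP[wd wb] wc]].
    by do 3!case: (rel_of C u _).
  case: ifP => // rw; have : w \in nbh (rel_of C) u by rewrite inE.
  by move/(subsetP Csub); rewrite uE !inE (negPf wd) (negPf wb) (negPf wc).
have even w := smith u w cubG cardG us memE.
have ed := even d; have eb := even b; have ec := even c.
(* In the 3 by 3 incidence table of cycles and edges at [u], the rows sum to two, so the total is
   six. Each column sum is even and at most three, hence equal to two: exactly one cycle misses
   [d]. *)
rewrite (eq_in_count missE).
case: s s3 row ed eb ec {us memE C0 hamN missE even} => [|C1 [|C2 [|C3 [|]]]] //= _ row.
have := row C1; have := row C2; have := row C3.
rewrite !inE !eqxx ?orbT => /(_ isT) + /(_ isT) + /(_ isT).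
do 9!case: (rel_of _ _ _) => //=.
Qed.

(** * Quotients of relations *)

Section Quotient.
Variables (T U : finType) (f : T -> U) (r : rel T).

(** Edges inside a class are discarded, so that the quotient has no loops. *)
Definition quo : rel U := fun a b =>
  (a != b) && [exists p, exists q, [&& r p q, f p == a & f q == b]].

Lemma quoP a b :
  reflect (a != b /\ exists p q, [/\ r p q, f p = a & f q = b]) (quo a b).
Proof.
apply: (iffP andP) => -[nab]; last first.
  case=> p [q [rpq fp fq]]; split=> //; apply/existsP; exists p.
  by apply/existsP; exists q; rewrite rpq fp fq !eqxx.
case/existsP=> p /existsP[q /and3P[rpq /eqP fp /eqP fq]].
by split=> //; exists p, q.
Qed.

Lemma quo_sym : symmetric r -> symmetric quo.
Proof.
move=> symr a b; apply/quoP/quoP=> -[nab [p [q [rpq fp fq]]]];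
by rewrite eq_sym; split=> //; exists q, p; rewrite symr.
Qed.

(** The preimage under [f] of a closed set is closed. *)
Lemma quo_connected : connected_rel r -> connected_rel quo.
Proof.
move=> conn K clK a b /suppP[a' /quoP[_ [p [q [rpq fp fq]]]]].
move=> /suppP[b' /quoP[_ [s [t [rst fs ft]]]]] aK.
suff : s \in f @^-1: K by rewrite inE fs.
apply: (conn _ _ p); rewrite ?(mem_supp rpq) ?(mem_supp rst) ?inE ?fp //.
move=> c d rcd; rewrite !inE => fcK.
have [<- //|ncd] := eqVneq (f c) (f d).
by apply: clK fcK; apply/quoP; split=> //; exists c, d.
Qed.

End Quotient.

(** If [k] exceeded three, there would be at least five vertices, and deleting the three neighbours
    of [x] would cut [x] off from a fifth one. *)
Lemma k_connected_cubic_le3 (G : sgraph) k : cubic G -> k_connected k G -> k <= 3.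
Proof.
move=> cubG [kG conn]; rewrite leqNgt; apply/negP=> k3.
have /card_gt0P[x _] : 0 < #|G| by apply: leq_trans kG.
pose S := nbh (@adj G) x; have S3 : #|S| = 3 by apply: cubG.
have xS : x \notin S by rewrite inE adj_irrefl.
have /subsetPn[y _] : ~~ ([set: G] \subset x |: S).
  apply: contraL kG => /subset_leq_card; rewrite cardsT cardsU1 xS S3 => G4.
  by rewrite -leqNgt (leq_trans G4).
rewrite in_setU1 negb_or => /andP[yx yS].
have /connected_offP/(_ [set x]) connS : connected (del_vertices S).
  by apply: conn; rewrite S3.
have : y \in [set x]; last by rewrite inE (negPf yx).
apply: (connS _ x) => //; last by rewrite set11.
move=> a b aS bS ab; rewrite !inE => /eqP ax.
by move: bS; rewrite inE -ax ab.
Qed.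

(** * Substituting [G2 - u] for the vertices of a cubic graph *)

Section Substitution.
Variables (G2 H : sgraph) (u : G2) (emb : H -> G2) (x0 : H).

(** The graph [H] with [emb] stands for [G2] without [u]. Its attachment vertices are listed in a
    fixed order so that they can be matched by position. *)
Definition terminals : seq H := enum [set x | adj u (emb x)].

Section Definitions.
Variable G : sgraph.

(** The vertex in the copy at [v] to which the edge towards [w] is attached: the i-th neighbour of
    [v] gets the i-th terminal. For adjacent [v] and [w] in a cubic graph both lists have three
    entries and the default [x0] is not reached. *)
Definition port (v w : G) : H := nth x0 terminals (index w (enum (nbh (@adj G) v))).

Definition subst_adj : rel (G * H) := fun p q =>
  (p.1 == q.1) && adj p.2 q.2 ||
  [&& adj p.1 q.1, p.2 == port p.1 q.1 & q.2 == port q.1 p.1].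

Lemma subst_adj_sym : symmetric subst_adj.
Proof.
move=> p q; rewrite /subst_adj eq_sym adj_sym [adj p.1 _]adj_sym.
by rewrite [(p.2 == _) && _]andbC.
Qed.

Lemma subst_adj_irrefl : irreflexive subst_adj.
Proof. by move=> p; rewrite /subst_adj !adj_irrefl andbF. Qed.

Definition subst_graph : sgraph := SGraph subst_adj_sym subst_adj_irrefl.

Definition contr (v : G) (p : subst_graph) : G2 := if p.1 == v then emb p.2 else u.

End Definitions.

Hypotheses (emb_inj : injective emb) (emb_neq : forall x, emb x != u)
  (emb_surj : forall z, z != u -> exists x, emb x = z)
  (adj_emb : forall x y, adj (emb x) (emb y) = adj x y)
  (cub2 : cubic G2).

Lemma size_terminals : size terminals = 3.
Proof.
rewrite -cardE -(cub2 u) -(card_imset _ emb_inj); apply: eq_card => z.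
rewrite inE; apply/imsetP/idP=> [[x xt ->]|uz]; first by rewrite inE in xt.
have [x ex] : exists x, emb x = z.
  by apply: emb_surj; apply: contraTneq uz => ->; rewrite adj_irrefl.
by exists x; rewrite // inE ex.
Qed.

Section Cubic.
Variable G : sgraph.
Hypothesis cubG : cubic G.

Notation F := (subst_graph G).

Lemma port_adj (v w : G) : adj v w -> adj u (emb (port v w)).
Proof.
move=> vw; have : port v w \in terminals; last by rewrite mem_enum inE.
by rewrite mem_nth // size_terminals -(cubG v) cardE index_mem mem_enum inE.
Qed.

Lemma port_inj (v w w' : G) :
  adj v w -> adj v w' -> port v w = port v w' -> w = w'.
Proof.
move=> vw vw' /eqP; rewrite nth_uniq ?enum_uniq //; last 2 first.
- by rewrite size_terminals -(cubG v) cardE index_mem mem_enum inE.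
- by rewrite size_terminals -(cubG v) cardE index_mem mem_enum inE.
by move/eqP; apply: (index_inj v); rewrite mem_enum inE.
Qed.

Lemma port_surj (v : G) x : adj u (emb x) -> exists2 w, adj v w & port v w = x.
Proof.
move=> ux; have xt : x \in terminals by rewrite mem_enum inE.
have it : index x terminals < size (enum (nbh (@adj G) v)).
  by rewrite -cardE [#|_|]cubG -size_terminals index_mem.
exists (nth v (enum (nbh (@adj G) v)) (index x terminals)).
  by have := mem_nth v it; rewrite mem_enum inE.
by rewrite /port index_uniq ?enum_uniq // nth_index.
Qed.

Lemma adj_in (v : G) x y : @adj F (v, x) (v, y) = adj x y.
Proof. by rewrite /= /subst_adj /= eqxx adj_irrefl /= orbF. Qed.

Lemma adj_out (v w : G) x y : v != w ->
  @adj F (v, x) (w, y) = [&& adj v w, x == port v w & y == port w v].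
Proof. by rewrite /= /subst_adj /= => /negPf->. Qed.

Lemma contr_in (v : G) x : contr v (v, x) = emb x.
Proof. by rewrite /contr eqxx. Qed.

Lemma contr_out (v w : G) x : w != v -> contr v (w, x) = u.
Proof. by rewrite /contr /= => /negPf->. Qed.

Lemma contr_emb (v : G) (p : F) x : contr v p = emb x -> p = (v, x).
Proof.
case: p => w y; rewrite /contr /=; case: eqP => [-> /emb_inj-> //|_ ux].
by have := emb_neq x; rewrite -ux eqxx.
Qed.

(** Together with [contr_adj] and [contr_surj], this makes [contr v] a bijection between
    neighbourhoods at every vertex of the copy. A vertex of the copy has at most one neighbour
    outside, since distinct edges at [v] use distinct ports. *)
Lemma contr_inj (v : G) x (p q : F) :
  adj ((v, x) : F) p -> adj ((v, x) : F) q -> contr v p = contr v q -> p = q.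
Proof.
case: p q => [w y] [w' y']; have [<-|nw] := eqVneq v w.
  by rewrite contr_in => _ _ /esym/contr_emb->.
have [<-|nw'] := eqVneq v w'.
  by rewrite contr_in => _ _ /contr_emb->.
rewrite !adj_out // => /and3P[vw /eqP-> /eqP->] /and3P[vw' /eqP ep /eqP->] _.
by rewrite (port_inj vw vw' ep).
Qed.

Lemma contr_adj (v : G) x (p : F) :
  adj ((v, x) : F) p -> adj (emb x) (contr v p).
Proof.
case: p => w y; have [<-|nw] := eqVneq v w; first by rewrite contr_in adj_in adj_emb.
rewrite adj_out // contr_out; last by rewrite eq_sym.
case/and3P=> [vw /eqP-> _].
by rewrite adj_sym port_adj.
Qed.

Lemma contr_surj (v : G) x z :
  adj (emb x) z -> exists2 p : F, adj ((v, x) : F) p & contr v p = z.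
Proof.
have [->|zu] := eqVneq z u.
  rewrite adj_sym => /(port_surj v)[w vw <-].
  have nvw : v != w by apply: contraTneq vw => ->; rewrite adj_irrefl.
  exists (w, port w v); first by rewrite adj_out // vw !eqxx.
  by rewrite contr_out // eq_sym.
have [y <-] := emb_surj zu; rewrite adj_emb => xy.
by exists (v, y); rewrite ?adj_in ?contr_in.
Qed.

Lemma cubic_subst : cubic F.
Proof.
case=> v x; rewrite -(cub2 (emb x)) -(card_in_imset (f := contr v)).
  apply: eq_card => z; rewrite [RHS]inE; apply/imsetP/idP.
    by case=> p; rewrite inE => xp ->; apply: contr_adj.
  by case/(contr_surj v)=> p xp <-; exists p; rewrite ?inE.
by move=> p q; rewrite !inE; apply: contr_inj.
Qed.

Lemma card_subst : #|F| = #|G| * #|H|.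
Proof. exact: card_prod. Qed.

(** * The two contractions of a cycle of the new graph: to [G] and to [G2] *)

Section CycleInSubst.
Variable r : rel F.
Hypotheses (symr : symmetric r) (radj : subrel r (@adj F)).

(** Two copies are joined by at most one edge, so an edge of the quotient determines the edge of [r]
    it comes from. *)
Lemma quo_fstE (v w : G) : quo (fun p : F => p.1) r v w =
  adj v w && r (v, port v w) (w, port w v).
Proof.
apply/quoP/andP=> [[nvw [[a x] [[b y] [rpq /= av bw]]]]|[vw rvw]].
  subst a b; have := radj rpq; rewrite adj_out // => /and3P[vw /eqP ex /eqP ey].
  by rewrite vw -ex -ey.
split; first by apply: contraTneq vw => ->; rewrite adj_irrefl.
by exists (v, port v w), (w, port w v).
Qed.

Lemma nbh_quo_emb (v : G) x :
  nbh (quo (contr v) r) (emb x) = contr v @: nbh r (v, x).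
Proof.
apply/setP=> z; rewrite inE; apply/quoP/imsetP=> [[_ [p [q [rpq /contr_emb ep <-]]]]|].
  by exists q; rewrite // inE -ep.
case=> q; rewrite inE => rq ->; split.
  have := contr_adj (radj rq); apply: contraTneq => <-; rewrite adj_irrefl //.
by exists (v, x), q; rewrite contr_in.
Qed.

Lemma card_nbh_quo_emb (v : G) x :
  #|nbh (quo (contr v) r) (emb x)| = #|nbh r (v, x)|.
Proof.
rewrite nbh_quo_emb card_in_imset // => p q; rewrite !inE => /radj xp /radj xq.
exact: contr_inj xp xq.
Qed.

(** After contracting the outside, the edges at [u] are exactly the edges of [r] leaving the copy,
    which are also the edges at [v] in the quotient on [G]. *)
Lemma nbh_quo_u (v : G) :
  nbh (quo (contr v) r) u = (emb \o port v) @: nbh (quo (fun p : F => p.1) r) v.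
Proof.
apply/setP=> z; rewrite inE; apply/quoP/imsetP.
  case=> nuz [[w x] [[w' y] [rpq ep eq_]]].
  have nw : w != v.
    by apply: contraTneq isT => ew; have := emb_neq x; rewrite -ep ew contr_in eqxx.
  have ew' : w' = v.
    by apply: contraNeq nuz => nw'; rewrite -eq_ contr_out.
  subst w'; have := radj rpq; rewrite adj_out // => /and3P[wv /eqP ex /eqP ey].
  exists w; last by rewrite -eq_ contr_in ey.
  by rewrite inE quo_fstE adj_sym wv -ex -ey symr.
case=> w; rewrite inE quo_fstE => /andP[vw rvw] ->.
have nwv : w != v by apply: contraTneq vw => ->; rewrite adj_irrefl.
split; first by rewrite eq_sym emb_neq.
by exists (w, port w v), (v, port v w); rewrite symr rvw contr_in contr_out.
Qed.

Lemma card_nbh_quo_u (v : G) :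
  #|nbh (quo (contr v) r) u| = #|nbh (quo (fun p : F => p.1) r) v|.
Proof.
rewrite nbh_quo_u card_in_imset // => w w'; rewrite !inE !quo_fstE.
by move=> /andP[vw _] /andP[vw' _] /= /emb_inj/(port_inj vw vw').
Qed.

Lemma supp_quo_emb (v : G) x :
  (emb x \in supp (quo (contr v) r)) = ((v, x) \in supp r).
Proof. by rewrite !supp_nbh card_nbh_quo_emb. Qed.

Lemma supp_quo_u (v : G) :
  (u \in supp (quo (contr v) r)) = (v \in supp (quo (fun p : F => p.1) r)).
Proof. by rewrite !supp_nbh card_nbh_quo_u. Qed.

End CycleInSubst.

Section CycRelSubst.
Variable r : rel F.
Hypothesis cr : cyc_rel r.

Let symr : symmetric r. Proof. by case: cr. Qed.
Let radj : subrel r (@adj F). Proof. by case: cr. Qed.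

Notation r1 := (quo (fun p : F => p.1) r).

Definition fiber (v : G) : {set H} := [set x | ((v, x) : F) \in supp r].

(** Handshake argument: the degrees in [r] over the copy of [v] sum to an even number, and edges
    inside the copy are counted twice, so evenly many edges leave it. *)
Lemma even_nbh_fst (v : G) : ~~ odd #|nbh r1 v|.
Proof.
(* [X] consists of the directed edges starting in the copy, [Y] restricts them to those ending
   there; reversal pairs up the latter. *)
pose X := [set d : H * F | r (v, d.1) d.2].
pose Y := [set d : H * F | (d.2 : G * H).1 == v].
have : ~~ odd #|X|.
  rewrite -sum1dep_card -(pair_big_dep xpredT (fun x q => r (v, x) q) (fun _ _ => 1)) /=.
  apply: (big_ind (fun k => ~~ odd k)) => // [a b|x _].
    by rewrite oddD => /negPf-> /negPf->.
  rewrite sum1dep_card -/(nbh r (v, x)).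
  have [xr|/nbh_supp0->] := boolP (((v, x) : F) \in supp r); last by rewrite cards0.
  by have [_ _ -> ] := cr.
rewrite -(cardsID Y) oddD.
have /negPf-> : ~~ odd #|X :&: Y|.
  apply: (@even_fpf_involution _ _ (fun d => ((d.2 : G * H).2, (v, d.1)))) => -[x [w y]].
  rewrite !inE /= => /andP[rxy /eqP wv]; subst w; split=> //.
    by rewrite symr rxy eqxx.
  apply/eqP=> -[exy _]; have := radj rxy.
  by rewrite exy adj_irrefl.
rewrite addFb (_ : X :\: Y = [set (port v w, (w, port w v) : F) | w in nbh r1 v]).
  by rewrite card_imset // => w w' [].
apply/setP=> -[x [w y]]; rewrite !inE /=; apply/andP/imsetP.
  rewrite eq_sym => -[nvw rxy]; have := radj rxy; rewrite adj_out //.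
  case/and3P=> vw /eqP ex /eqP ey; exists w; last by rewrite ex ey.
  by rewrite inE quo_fstE // vw -ex -ey.
case=> w'; rewrite inE quo_fstE // => /andP[vw rvw] [-> -> ->]; split=> //.
by apply: contraTneq vw => ->; rewrite adj_irrefl.
Qed.

(** The number is even, positive and at most three: a cycle passes through a copy at most once. *)
Lemma card_nbh_fst (v : G) : v \in supp r1 -> #|nbh r1 v| = 2.
Proof.
rewrite supp_nbh => gt0; have := even_nbh_fst v.
have : #|nbh r1 v| <= 3.
  rewrite -(cubG v); apply/subset_leq_card/subsetP=> w.
  by rewrite !inE quo_fstE // => /andP[].
by case: #|_| gt0 => [|[|[|[|]]]].
Qed.

Lemma cyc_rel_fst : supp r1 != set0 -> cyc_rel r1.
Proof.
have [_ _ _ _ conn] := cr; move=> r10; split=> //.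
- exact: quo_sym.
- by move=> v w; rewrite quo_fstE // => /andP[].
- exact: card_nbh_fst.
- exact: quo_connected.
Qed.

(** Covers both a cycle inside the copy, which avoids [u] after contraction, and a cycle crossing
    the copy, which then passes through [u] with degree two by [card_nbh_fst]. *)
Lemma cyc_rel_contr (v : G) x : x \in fiber v -> cyc_rel (quo (contr v) r).
Proof.
rewrite inE => xr; have [_ _ deg _ conn] := cr; split.
- exact: quo_sym.
- move=> a b rab; have : b \in nbh (quo (contr v) r) a by rewrite inE.
  have [->|/emb_surj[y <-]] := eqVneq a u.
    rewrite nbh_quo_u // => /imsetP[w]; rewrite inE quo_fstE // => /andP[vw _] ->.
    exact: port_adj.
  by rewrite nbh_quo_emb // => /imsetP[p]; rewrite inE => /radj yp ->; apply: contr_adj.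
- move=> a; have [->|/emb_surj[y <-]] := eqVneq a u.
    by rewrite supp_quo_u // card_nbh_quo_u //; apply: card_nbh_fst.
  by rewrite supp_quo_emb // card_nbh_quo_emb //; apply: deg.
- by apply/set0Pn; exists (emb x); rewrite supp_quo_emb.
- exact: quo_connected.
Qed.

Lemma card_supp_contr (v : G) :
  #|supp (quo (contr v) r)| = (v \in supp r1) + #|fiber v|.
Proof.
rewrite (cardsD1 u) supp_quo_u // -(card_imset _ emb_inj); congr (_ + _).
apply: eq_card => z; rewrite in_setD1; apply/andP/imsetP=> [[zu]|[x]].
  by have [x <-] := emb_surj zu; rewrite supp_quo_emb // => xr; exists x; rewrite // in_set.
by rewrite inE => xr ->; rewrite supp_quo_emb.
Qed.

Lemma card_supp_fibers : #|supp r| = \sum_(v : G) #|fiber v|.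
Proof.
under eq_bigr do rewrite -sum1dep_card.
rewrite -sum1_card pair_big_dep /=.
by apply: eq_bigl => -[v x].
Qed.

(** No edge of [r] leaves the copy of [v], so the copy is a closed set and contains the whole
    connected cycle. *)
Lemma supp_sub_copy (v : G) x (p : F) :
  v \notin supp r1 -> x \in fiber v -> p \in supp r -> p.1 = v.
Proof.
move=> vr1; rewrite [x \in _]in_set => xr pr; have [_ _ _ _ conn] := cr.
suff : p \in [set q : F | q.1 == v] by rewrite inE => /eqP.
apply: (conn _ _ (v, x)) => //; last by rewrite inE.
move=> a b rab; rewrite !inE => /eqP av.
rewrite eq_sym; apply: contraNT vr1 => nvb; apply: (@mem_supp _ _ _ b.1).
by apply/quoP; split=> //; exists a, b.
Qed.

Lemma fiber_fst (v : G) x : supp r1 != set0 -> x \in fiber v -> v \in supp r1.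
Proof.
case/set0Pn=> w wr xr; apply: contraT => vr.
have /suppP[w'] := wr; rewrite quo_fstE // => /andP[_ /mem_supp wr'].
by have /= wv := supp_sub_copy vr xr wr'; rewrite -wv wr in vr.
Qed.

Lemma card_supp_fst : supp r1 != set0 -> #|supp r| = \sum_(v in supp r1) #|fiber v|.
Proof.
move=> r10; rewrite card_supp_fibers [RHS]big_mkcond; apply: eq_bigr => v _.
case: ifPn => // vr; apply/eqP; rewrite cards_eq0; apply/set0Pn=> -[x xr].
by rewrite (fiber_fst r10 xr) in vr.
Qed.

Lemma card_supp_copy : supp r1 = set0 ->
  exists v x, x \in fiber v /\ #|supp r| = #|fiber v|.
Proof.
move=> r10; have [_ _ _ /set0Pn[[v x] vxr] _] := cr.
have vr : v \notin supp r1 by rewrite r10 inE.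
have xr : x \in fiber v by rewrite inE.
exists v, x; split=> //; rewrite card_supp_fibers (bigD1 v) //= big1 ?addn0 //.
move=> w nwv; apply/eqP; rewrite cards_eq0; apply/set0Pn=> -[y]; rewrite inE.
by move/(supp_sub_copy vr xr)=> /= wv; rewrite wv eqxx in nwv.
Qed.

Lemma quo_contr_in (v : G) x y : quo (contr v) r (emb x) (emb y) = r (v, x) (v, y).
Proof.
apply/quoP/idP=> [[_ [p [q [rpq /contr_emb <- /contr_emb <-]]]] //|rxy].
split; last by exists (v, x), (v, y); rewrite !contr_in.
apply: contraTneq (radj rxy) => /emb_inj->.
by rewrite adj_irrefl.
Qed.

(** A cycle inside a copy is a cycle of [G2]. Any other one visits at least [g] copies, and has at
    least two vertices in each, because its contraction to [G2] is a cycle through [u] with at least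
    three vertices. *)
Lemma girth_subst g g2 :
  (forall C : subgraph G, is_cycle C -> g <= cycle_length C) ->
  (forall C : subgraph G2, is_cycle C -> g2 <= cycle_length C) ->
  minn (2 * g) g2 <= #|supp r|.
Proof.
move=> girth1 girth2; rewrite geq_min; apply/orP.
have [r10|r10] := eqVneq (supp r1) set0.
  right; have [v [x [xr ->]]] := card_supp_copy r10.
  have cv := cyc_rel_contr xr.
  have := girth2 _ (cyc_rel_is_cycle cv).
  by rewrite cycle_length_rel // card_supp_contr r10 inE.
left; have c1 := cyc_rel_fst r10.
have := girth1 _ (cyc_rel_is_cycle c1); rewrite cycle_length_rel // => leg.
rewrite card_supp_fst // (leq_trans (leq_mul (leqnn 2) leg)) // mulnC -sum_nat_const.
apply: leq_sum => v vr1; have /suppP[w] := vr1.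
rewrite quo_fstE // => /andP[_ /mem_supp vr].
have xr : port v w \in fiber v by rewrite inE.
by have := cyc_rel_gt2 (cyc_rel_contr xr); rewrite card_supp_contr vr1.
Qed.

End CycRelSubst.

(** * Expanding a cycle of [G] by hamiltonian paths of the copies, and the unique longest cycle *)

Section Expansion.
Variable ham : {set G2} -> subgraph G2.
Hypothesis hamP : forall A : {set G2}, A \subset nbh (@adj G2) u -> #|A| = 2 ->
  [/\ hamiltonian_cycle (ham A), nbh (rel_of (ham A)) u = A &
      forall C, hamiltonian_cycle C -> nbh (rel_of C) u = A -> C = ham A].

(** For a cycle [rs] through [v], the pair of neighbours of [u] that selects the hamiltonian cycle
    to be inserted at [v]. *)
Definition ends (rs : rel G) (v : G) : {set G2} := (emb \o port v) @: nbh rs v.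

Definition expand (rs : rel G) : rel F := fun p q =>
  if p.1 == q.1 then (p.1 \in supp rs) && rel_of (ham (ends rs p.1)) (emb p.2) (emb q.2)
  else [&& rs p.1 q.1, p.2 == port p.1 q.1 & q.2 == port q.1 p.1].

Lemma eq_ends (r1 r2 : rel G) v : r1 =2 r2 -> ends r1 v = ends r2 v.
Proof.
move=> e; rewrite /ends; suff -> : nbh r1 v = nbh r2 v by [].
by apply/setP=> w; rewrite !inE e.
Qed.

Section ExpandCycle.
Variable rs : rel G.
Hypothesis crs : cyc_rel rs.

Let symrs : symmetric rs. Proof. by case: crs. Qed.
Let adjrs : subrel rs (@adj G). Proof. by case: crs. Qed.

Lemma ends_sub v : ends rs v \subset nbh (@adj G2) u.
Proof.
apply/subsetP=> z /imsetP[w]; rewrite inE => /adjrs vw ->.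
by rewrite inE; apply: port_adj.
Qed.

Lemma card_ends v : v \in supp rs -> #|ends rs v| = 2.
Proof.
move=> vs; have [_ _ deg _ _] := crs; rewrite -(deg v vs) card_in_imset //.
by move=> w w'; rewrite !inE => /adjrs vw /adjrs vw' /= /emb_inj/(port_inj vw vw').
Qed.

Lemma cyc_rel_ham v : v \in supp rs -> cyc_rel (rel_of (ham (ends rs v))).
Proof. by move/card_ends/(hamP (ends_sub v))=> [[/is_cycle_cyc_rel]]. Qed.

Lemma supp_ham v z : v \in supp rs -> z \in supp (rel_of (ham (ends rs v))).
Proof.
by move/card_ends/(hamP (ends_sub v))=> [[cyc h1] _ _]; rewrite is_cycle_supp // h1 inE.
Qed.

Lemma ham_u v z : v \in supp rs ->
  rel_of (ham (ends rs v)) u z = (z \in ends rs v).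
Proof. by move/card_ends/(hamP (ends_sub v))=> [_ /setP/(_ z) + _]; rewrite inE. Qed.

Lemma expand_in v x y : v \in supp rs ->
  expand rs (v, x) (v, y) = rel_of (ham (ends rs v)) (emb x) (emb y).
Proof. by move=> vs; rewrite /expand eqxx vs. Qed.

Lemma expand_out v w x y : v != w ->
  expand rs (v, x) (w, y) = [&& rs v w, x == port v w & y == port w v].
Proof. by rewrite /expand /= => /negPf->. Qed.

Lemma expand_port v w : rs v w -> expand rs (v, port v w) (w, port w v).
Proof.
move=> rvw; rewrite expand_out ?rvw ?eqxx //.
by apply: contraTneq (adjrs rvw) => ->; rewrite adj_irrefl.
Qed.

Lemma expand_sym : symmetric (expand rs).
Proof.
move=> [v x] [w y]; rewrite /expand /= eq_sym; case: eqP => [->|_].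
  by rewrite /rel_of setUC.
by rewrite symrs [(x == _) && _]andbC.
Qed.

Lemma expand_adj : subrel (expand rs) (@adj F).
Proof.
move=> [v x] [w y]; have [<-|nvw] := eqVneq v w.
  rewrite adj_in /expand eqxx => /andP[/cyc_rel_ham[_ sub _ _ _] /sub].
  by rewrite adj_emb.
by rewrite expand_out // adj_out // => /and3P[/adjrs-> -> ->].
Qed.

(** Seen from the copy of [v], the expanded relation is the inserted hamiltonian cycle, with [u]
    standing for the outside; degree two is inherited from it. *)
Lemma contr_expand v x : v \in supp rs ->
  contr v @: nbh (expand rs) (v, x) = nbh (rel_of (ham (ends rs v))) (emb x).
Proof.
move=> vs; have [symh _ _ _ _] := cyc_rel_ham vs.
apply/setP=> z; rewrite [RHS]inE; apply/imsetP/idP=> [[[w y]]|].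
  rewrite inE; have [<-|nvw] := eqVneq v w.
    by rewrite expand_in // contr_in => + ->.
  rewrite expand_out // => /and3P[rvw /eqP-> _] ->.
  rewrite contr_out 1?eq_sym // symh ham_u //.
  by apply/imsetP; exists w; rewrite ?inE.
have [->|/emb_surj[y <-]] := eqVneq z u; last first.
  by exists (v, y); rewrite ?inE ?expand_in ?contr_in.
rewrite symh ham_u // => /imsetP[w]; rewrite inE => rvw /emb_inj ->.
exists (w, port w v); first by rewrite inE expand_port.
rewrite contr_out //.
by apply: contraTneq (adjrs rvw) => ->; rewrite adj_irrefl.
Qed.

Lemma card_nbh_expand v x : v \in supp rs -> #|nbh (expand rs) (v, x)| = 2.
Proof.
move=> vs; rewrite -(card_in_imset (f := contr v)).
  rewrite contr_expand //; have [_ _ deg _ _] := cyc_rel_ham vs.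
  by rewrite deg // supp_ham.
by move=> p q; rewrite !inE => /expand_adj xp /expand_adj; apply: contr_inj.
Qed.

Lemma supp_expand v x : (((v, x) : F) \in supp (expand rs)) = (v \in supp rs).
Proof.
apply/idP/idP=> [/suppP[[w y]]|vs]; last by rewrite supp_nbh card_nbh_expand.
have [<-|nvw] := eqVneq v w; first by rewrite /expand eqxx => /andP[].
by rewrite expand_out // => /andP[/mem_supp].
Qed.

Lemma card_supp_expand : #|supp (expand rs)| = #|supp rs| * #|H|.
Proof.
rewrite -[#|H|]cardsT -cardsX; apply: eq_card => -[v x].
by rewrite supp_expand in_setX in_setT andbT.
Qed.

(** A closed set meeting a copy contains all of it, since a hamiltonian cycle without [u] is
    connected; it then spreads from copy to copy along [rs] through the ports. *)
Lemma expand_connected : connected_rel (expand rs).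
Proof.
move=> K clK [v x] [w y]; rewrite !supp_expand => vs ws vK.
have copy a b c : a \in supp rs -> ((a, b) : F) \in K -> ((a, c) : F) \in K.
  move=> sa bK; pose K2 := emb @: [set d | ((a, d) : F) \in K].
  have K2E d : (emb d \in K2) = (((a, d) : F) \in K) by rewrite mem_imset // inE.
  rewrite -K2E in bK; rewrite -K2E.
  apply: (cyc_rel_minus_vertex (cyc_rel_ham sa) (supp_ham u sa) _ _ _ _ _ bK);
    rewrite ?supp_ham //.
  move=> a' b' + /emb_surj[d ed] /emb_surj[e ee]; rewrite -ed -ee !K2E => rde.
  by apply: clK; rewrite expand_in.
have [_ _ _ _ conn] := crs.
apply: (copy w x) => //.
suff : w \in [set a | [forall b, ((a, b) : F) \in K]].
  by rewrite inE => /forallP/(_ x).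
apply: (conn _ _ v w vs ws); last by rewrite inE; apply/forallP=> b; apply: copy vK.
move=> a b rab; rewrite !inE => /forallP aK; apply/forallP=> c.
apply: (copy b (port b a)); first by apply: (@mem_supp _ _ _ a); rewrite symrs.
by apply: clK (aK (port a b)); apply: expand_port.
Qed.

Lemma cyc_rel_expand : cyc_rel (expand rs).
Proof.
split.
- exact: expand_sym.
- exact: expand_adj.
- by case=> v x; rewrite supp_expand; apply: card_nbh_expand.
- have [_ _ _ /set0Pn[v vs] _] := crs.
  by apply/set0Pn; exists (v, x0); rewrite supp_expand.
- exact: expand_connected.
Qed.

End ExpandCycle.

(** In each visited copy the contraction of [r] is a hamiltonian cycle of [G2] with neighbourhood
    [ends rs v] at [u], so the uniqueness in [hamP] identifies it. *)
Lemma full_fibers_expand (r : rel F) (rs : rel G) :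
  cyc_rel r -> cyc_rel rs -> quo (fun p : F => p.1) r =2 rs ->
  {in supp rs, forall v, fiber r v = [set: H]} -> r =2 expand rs.
Proof.
move=> cr crs r1E full [v x] [w y]; have [symr radj _ _ _] := cr.
have supp1 : supp (quo (fun p : F => p.1) r) = supp rs by apply: eq_supp.
have [<-|nvw] := eqVneq v w; last first.
  rewrite expand_out // -r1E quo_fstE //; apply/idP/and3P.
    move=> rvw; have := radj _ _ rvw; rewrite adj_out // => /and3P[-> /eqP ex /eqP ey].
    by rewrite -ex -ey rvw !eqxx.
  by case=> /andP[_ rvw] /eqP-> /eqP->.
have [vs|vs] := boolP (v \in supp rs); last first.
  rewrite /expand eqxx (negPf vs); apply/negP=> rxy; case/negP: vs.
  rewrite -supp1; apply: (fiber_fst (x := x) cr); last by rewrite in_set (mem_supp rxy).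
  by rewrite supp1; case: crs.
have xv : x \in fiber r v by rewrite full // in_setT.
have c2 := cyc_rel_contr cr xv.
have [sym2 _ _ _ _] := c2.
rewrite expand_in // -quo_contr_in //.
have [_ _ uniq_ham] := hamP (ends_sub crs v) (card_ends crs vs).
rewrite -(uniq_ham (subgraph_of_rel (quo (contr v) r))) ?rel_ofK //.
  split; first exact: cyc_rel_is_cycle.
  apply/setP=> z; rewrite in_setT; have [->|/emb_surj[y' <-]] := eqVneq z u.
    by rewrite /= supp_quo_u // supp1 vs.
  rewrite /= supp_quo_emb //.
  by have /setP/(_ y') := full v vs; rewrite !in_set.
rewrite -(eq_ends _ r1E) /ends -nbh_quo_u //.
by apply/setP=> z; rewrite !inE rel_ofK.
Qed.

Lemma card_H_gt2 : 2 < #|H|.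
Proof. by rewrite -size_terminals -(card_uniqP (enum_uniq _)) max_card. Qed.

(** A cycle has at most [#|H|] vertices in each copy it visits. Reaching the bound forces the
    quotient to be the longest cycle of [G] and every visited copy to be filled. *)
Lemma unique_longest_subst : unique_longest_cycle G -> unique_longest_cycle F.
Proof.
case=> C0 [[cyc0 max0] uniq0]; set rs := rel_of C0.
have crs : cyc_rel rs by apply: is_cycle_cyc_rel.
have lenE : cycle_length C0 = #|supp rs| by rewrite cycle_lengthE // is_cycle_supp.
have h2 := card_H_gt2.
have bound r : cyc_rel r -> #|supp r| <= #|supp rs| * #|H| /\
    (#|supp rs| * #|H| <= #|supp r| -> r =2 expand rs).
  move=> cr; have [symr radj _ _ _] := cr.
  have [r10|r10] := eqVneq (supp (quo (fun p : F => p.1) r)) set0.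
    (* A cycle inside one copy has at most [#|H|] vertices, whereas [rs] has at least three, so it
       stays strictly below the bound. *)
    have [v [x [xr ->]]] := card_supp_copy cr r10.
    have := max_card (mem (fiber r v)); have := cyc_rel_gt2 crs.
    move: #|_| #|mem _| h2 => a b; set h := #|H|; nia.
  have c1 := cyc_rel_fst cr r10.
  set r1 := quo _ _ in r10 c1.
  have le1 : #|supp r1| <= #|supp rs|.
    by rewrite -cycle_length_rel // -lenE; apply/max0/cyc_rel_is_cycle.
  have lef v : #|fiber r v| <= #|H| by apply: max_card.
  have supE := card_supp_fst cr r10; rewrite -/r1 in supE.
  have les : #|supp r| <= #|supp r1| * #|H|.
    by rewrite supE -sum_nat_const; apply: leq_sum.
  split; first by rewrite (leq_trans les) // leq_mul2r le1 orbT.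
  move=> ge; have eq1 : #|supp r1| = #|supp rs|.
    apply/eqP; rewrite eqn_leq le1 -(leq_pmul2r (ltn_trans _ h2)) //.
    exact: leq_trans ge les.
  have r1E : r1 =2 rs.
    have /uniq0 e : longest_cycle (subgraph_of_rel r1).
      split; first exact: cyc_rel_is_cycle.
      by move=> D /max0; rewrite cycle_length_rel // eq1 lenE.
    by move=> v w; rewrite /rs e rel_ofK //; case: c1.
  apply: full_fibers_expand => // v vs.
  have vr1 : v \in supp r1 by rewrite (eq_supp r1E).
  apply/eqP; rewrite eqEcard subsetT cardsT /=.
  (* Equality in the bound makes the total deficiency of the fibers vanish, hence each single
     one. *)
  have : \sum_(w in supp r1) (#|H| - #|fiber r w|) == 0.
    by rewrite sumnB // sum_nat_const subn_eq0 -supE eq1.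
  rewrite sum_nat_eq0 => /forallP/(_ v)/implyP/(_ vr1).
  by rewrite subn_eq0.
have ce := cyc_rel_expand crs.
exists (subgraph_of_rel (expand rs)); split.
  split; first exact: cyc_rel_is_cycle.
  move=> D cycD; rewrite cycle_length_rel // card_supp_expand //.
  rewrite cycle_lengthE // -is_cycle_supp //.
  by have [] := bound _ (is_cycle_cyc_rel cycD).
move=> D [cycD maxD]; rewrite -(is_cycleK cycD); apply: eq_subgraph_of_rel => p q.
apply/esym; have [_ ->//] := bound _ (is_cycle_cyc_rel cycD).
have := maxD _ (cyc_rel_is_cycle ce).
by rewrite cycle_length_rel // card_supp_expand // cycle_lengthE // -is_cycle_supp.
Qed.

End Expansion.

(** * Connectivity of the new graph *)

Lemma open_port (v : G) (S : {set F}) : #|S| < 3 ->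
  exists w, [/\ adj v w, ((v, port v w) : F) \notin S & forall y, ((w, y) : F) \notin S].
Proof.
move=> S3.
(* A deleted vertex blocks at most one neighbour of [v]: the one whose port it is, or the one in
   whose copy it lies. Fewer than three deletions leave one of the three neighbours unblocked. The
   default [v] is harmless, since [v] is not its own neighbour. *)
pose f (p : F) := if p.1 == v then odflt v [pick w | adj v w && (port v w == p.2)]
                  else p.1.
have : ~~ (nbh (@adj G) v \subset f @: S).
  apply: contraL S3 => /subset_leq_card; rewrite [#|nbh _ _|]cubG -leqNgt => le3.
  exact: leq_trans le3 (leq_imset_card _ _).
case/subsetPn=> w; rewrite inE => vw wS; exists w; split=> // [|y].
  apply: contra wS => pS; apply/imsetP; exists (v, port v w) => //.
  rewrite /f eqxx; case: pickP => [w' /andP[vw' /eqP ep]|/(_ w)] /=.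
    exact: port_inj vw vw' (esym ep).
  by rewrite vw eqxx.
apply: contra wS => wS; apply/imsetP; exists (w, y) => //; rewrite /f /= ifN //.
by apply: contraTneq vw => ->; rewrite adj_irrefl.
Qed.

(** What survives of each copy is connected since it loses fewer than [k2] vertices. The graph [G]
    without the damaged copies is connected since there are fewer than [k] of these, and each copy
    has an intact exit to an undamaged one by [open_port]. *)
Lemma k_connected_subst k k2 :
  k_connected k G -> k_connected k2 H -> k_connected (minn k k2) F.
Proof.
move=> kG [k2H conn2]; have [kltG conn1] := kG; split.
  rewrite card_subst (leq_ltn_trans (geq_minr _ _)) // (leq_trans k2H) //.
  by rewrite leq_pmull // (leq_ltn_trans _ kltG).
move=> S; rewrite leq_min => /andP[Sk Sk2]; apply/connected_offP => K clK.
have S3 : #|S| < 3 by apply: leq_trans Sk (k_connected_cubic_le3 cubG kG).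
have copy (v : G) x y : ((v, x) : F) \notin S -> ((v, y) : F) \notin S ->
    ((v, x) : F) \in K -> ((v, y) : F) \in K.
  move=> xS yS xK; pose Sv := [set z | ((v, z) : F) \in S].
  have Svk2 : #|Sv| < k2.
    apply: leq_ltn_trans Sk2; rewrite -(card_imset (mem Sv) (f := pair v)).
      by apply/subset_leq_card/subsetP=> p /imsetP[z]; rewrite inE => zS ->.
    by move=> a b [].
  have /connected_offP/(_ [set z | ((v, z) : F) \in K]) connv := conn2 Sv Svk2.
  have := connv _ x y; rewrite !inE; apply=> // a b; rewrite !inE => aS bS ab.
  by apply: clK => //; rewrite adj_in.
pose S1 := [set p.1 | p : F in S].
have notS1 (w : G) : (forall y, ((w, y) : F) \notin S) -> w \notin S1.
  by move=> wS; apply/imsetP=> -[[a b] + wa]; rewrite /= in wa; rewrite -wa (negPf (wS b)).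
have S1k : #|S1| < k by apply: leq_ltn_trans (leq_imset_card _ _) Sk.
(* By [copy], the survivors in one copy lie all in [K] or all outside, so [K1] decides membership
   for the entire copy. *)
pose K1 := [set w : G | [exists y, (((w, y) : F) \notin S) && (((w, y) : F) \in K)]].
have K1P (w : G) y : ((w, y) : F) \notin S -> (w \in K1) = (((w, y) : F) \in K).
  move=> wyS; rewrite inE; apply/existsP/idP=> [[z /andP[zS zK]]|yK].
    exact: copy zK.
  by exists y; rewrite wyS.
have step (v w : G) : adj v w -> ((v, port v w) : F) \notin S ->
    ((w, port w v) : F) \notin S -> (v \in K1) = (w \in K1).
  move=> vw vS wS; rewrite (K1P v _ vS) (K1P w _ wS).
  have nvw : v != w by apply: contraTneq vw => ->; rewrite adj_irrefl.
  have avw : @adj F (v, port v w) (w, port w v) by rewrite adj_out // vw !eqxx.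
  by apply/idP/idP; apply: clK; rewrite // adj_sym.
have /connected_offP/(_ K1) conn := conn1 S1 S1k.
move=> [v x] [v' x'] vS v'S vK.
(* The copies of [v] and [v'] may themselves be damaged, so both ends are first moved to undamaged
   neighbouring copies. *)
have [w [vw pS wS]] := open_port v S3; have [w' [vw' pS' wS']] := open_port v' S3.
rewrite -(K1P _ _ v'S) (step _ w') //.
apply: (conn _ w); rewrite ?notS1 //; last by rewrite -(step v w) // (K1P _ x).
move=> a b aS bS ab; rewrite (step a b) //.
  by apply: contra aS => abS; apply/imsetP; exists (a, port a b).
by apply: contra bS => abS; apply/imsetP; exists (b, port b a).
Qed.

End Cubic.
End Substitution.

(** * The infinite family *)

(** The girth is found as the least length of a cycle; ranging over tuples makes the existence of a
    cycle of given length decidable, and [C] provides one length. *)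
Lemma exists_girth (G : sgraph) (C : subgraph G) m :
  is_cycle C -> (forall D : subgraph G, is_cycle D -> m <= cycle_length D) ->
  exists2 g, has_girth G g & m <= g.
Proof.
move=> [c0 [c02 cyc0 _]] lbm.
pose P n := (2 < n) && [exists t : n.-tuple G, ucycleb (@adj G) t].
have memP c : 2 < size c -> ucycle (@adj G) c -> P (size c).
  by move=> c2 cc; rewrite /P c2; apply/existsP; exists (in_tuple c).
have exP : exists n, P n by exists (size c0); apply: memP.
have [g /andP[g2 /existsP[t ct]] ming] := ex_minnP exP.
have t2 : 2 < size t by rewrite size_tuple.
have tcyc : is_cycle (subgraph_of_seq t) by exists t.
have tlen : cycle_length (subgraph_of_seq t) = g.
  by rewrite /cycle_length card_edges_seq // size_tuple.
exists g; last by rewrite -tlen; apply: lbm.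
split; first by exists (subgraph_of_seq t).
move=> D [c [c2 cc ->]]; rewrite /cycle_length card_edges_seq //.
exact: ming (memP c c2 cc).
Qed.

Lemma sgraph_iso_card (G1 G2 : sgraph) : sgraph_iso G1 G2 -> #|G1| = #|G2|.
Proof. by case=> f bij_f _; apply: bij_eq_card bij_f. Qed.

Theorem mainTheorem1 (k1 k2 g1 g2 : nat)
    (k1_gt0 : 0 < k1) (k2_gt0 : 0 < k2) (g1_gt0 : 0 < g1) (g2_gt0 : 0 < g2)
    (exG1 : exists G1 : sgraph,
       [/\ cubic G1, k_connected k1 G1, has_girth G1 g1 &
           unique_longest_cycle G1])
    (exG2 : exists G2 : sgraph,
       [/\ cubic G2, has_girth G2 g2, num_hamiltonian_cycles G2 3 &
           exists u : G2, k_connected k2 (del_vertices [set u])]) :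
  exists F : nat -> sgraph,
    (forall i j : nat, i <> j -> ~ sgraph_iso (F i) (F j)) /\
    (forall i : nat,
       [/\ cubic (F i), k_connected (minn k1 k2) (F i),
           (exists2 g : nat, has_girth (F i) g & minn (2 * g1) g2 <= g) &
           unique_longest_cycle (F i)]).
Proof.
have [G1 [cub1 conn1 [_ girth1] long1]] := exG1.
have [G2 [cub2 [_ girth2] ham2 [u conn2]]] := exG2.
pose H := del_vertices [set u]; pose emb (x : H) : G2 := val (x : {x | x \notin [set u]}).
have emb_inj : injective emb by apply: val_inj.
have emb_neq x : emb x != u by have := valP (x : {x | x \notin [set u]}); rewrite inE.
have emb_surj z : z != u -> exists x, emb x = z.
  move=> zu; have zS : z \notin [set u] by rewrite inE.
  by exists (Sub z zS).
have adj_emb x y : adj (emb x) (emb y) = adj x y by [].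
have /card_gt0P[x0 _] : 0 < #|H| by have [lt_k2 _] := conn2; apply: leq_ltn_trans lt_k2.
have [ham hamP] := three_hamiltonian_cycles u cub2 ham2.
(* At least one substitution is made, because [G1] itself is only known to have girth [g1]. *)
pose F i := iter i.+1 (subst_graph u emb x0) G1.
have h2 : 2 < #|H| by apply: (card_H_gt2 emb_inj emb_surj cub2).
have cub_subst := @cubic_subst _ _ _ _ x0 emb_inj emb_neq emb_surj adj_emb cub2.
have Fcub i : cubic (F i) by elim: i => [|i IH]; apply: cub_subst.
have conn_subst := k_connected_subst x0 emb_inj emb_surj cub2.
have Fconn i : k_connected (minn k1 k2) (F i).
  elim: i => [|i IH]; first exact: conn_subst.
  (* The bound is stable under further substitutions, as the minimum with [k2] has already been
     taken. *)
  rewrite (_ : minn k1 k2 = minn (minn k1 k2) k2); last by rewrite -minnA minnn.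
  exact: conn_subst (Fcub i) _ _ IH conn2.
have long_subst := unique_longest_subst x0 emb_inj emb_neq emb_surj adj_emb cub2.
have Flong i : unique_longest_cycle (F i).
  elim: i => [|i IH]; first exact: long_subst hamP long1.
  exact: long_subst (Fcub i) _ hamP IH.
have girth_sub := @girth_subst _ _ _ _ x0 emb_inj emb_neq emb_surj adj_emb cub2.
have Fgirth i (C : subgraph (F i)) : is_cycle C -> minn (2 * g1) g2 <= cycle_length C.
  elim: i C => [|i IH] C cycC; rewrite cycle_lengthE // -is_cycle_supp //;
    have cC := is_cycle_cyc_rel cycC.
    exact: girth_sub cub1 _ cC _ _ girth1 girth2.
  (* The bound is at most [g2], so doubling it and taking the minimum with [g2] again does not
     decrease it. *)
  apply: leq_trans (girth_sub _ (Fcub i) _ cC _ _ IH girth2).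
  lia.
have Fcard i : #|F i| = #|G1| * #|H| ^ i.+1.
  by elim: i => [|i IH]; rewrite card_subst // IH -mulnA -expnSr.
(* The graphs are told apart by their orders, which grow strictly because [#|H|] exceeds one. *)
exists F; split=> [i j neq_ij /sgraph_iso_card|i].
  rewrite !Fcard => /eqP; rewrite eqn_pmul2l; last first.
    by have [lt_k1 _] := conn1; apply: leq_ltn_trans lt_k1.
  by rewrite eqn_exp2l ?(ltnW h2) // => /eqP[].
split=> //; have [C [[cycC _] _]] := Flong i.
exact: exists_girth cycC (Fgirth i).
Qed.
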